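(* Let $\lambda>0$, let $Q=(Q_j)_{j\ge 1}$ be any probability measure on $\mathbb{N}=\{1,2,\ldots\}$, and let $\mu=\mathrm{CP}_{\lambda,Q}$ be the compound Poisson measure on $\mathbb{Z}_+=\{0,1,2,\ldots\}$ with parameters $\lambda$ and $Q$. Then for every bounded function $f:\mathbb{Z}_+\to\mathbb{R}$, $$\mathrm{Ent}_{\mu}\big(e^f\big)\;\le\;\lambda\sum_{j\ge 1}Q_j\,E_{\mu}\Big[e^f\big\{|D^jf|\,e^{|D^jf|}-e^{|D^jf|}+1\big\}\Big],$$ where $D^jf(k)=f(k+j)-f(k)$ for $j\ge 1$, $k\in\mathbb{Z}_+$.
   Context: For $\lambda>0$ and a probability measure $Q=(Q_j)_{j\ge1}$ on $\mathbb{N}=\{1,2,\ldots\}$ (with $Q_j=Q(\{j\})$), the compound Poisson measure $\mathrm{CP}_{\lambda,Q}$ is the law on $\mathbb{Z}_+=\{0,1,2,\ldots\}$ of the random sum $Z=\sum_{i=1}^{W}X_i$ (equal to $0$ when $W=0$), where $W\sim\mathrm{Poisson}(\lambda)$ and $X_1,X_2,\ldots$ are i.i.d. with law $Q$, independent of $W$. For a probability measure $\mu$ and a nonnegative function $g$ on the same space, the entropy functional is $\mathrm{Ent}_\mu(g)=\int g\log g\,d\mu-\big(\int g\,d\mu\big)\log\big(\int g\,d\mu\big)$, whenever these integrals exist. $E_\mu$ denotes expectation with respect to $\mu$. *)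

(* Defs.v *)
From HB Require Import structures.
From mathcomp Require Import all_boot all_order all_algebra finmap.
From mathcomp Require Import all_classical all_reals all_analysis.
Set Implicit Arguments.
Unset Strict Implicit.
Unset Printing Implicit Defensive.
Import Order.TTheory GRing.Theory Num.Theory.
Import numFieldNormedType.Exports.
Local Open Scope classical_set_scope.
Local Open Scope ring_scope.
Local Open Scope ereal_scope.

Definition mutually_independent d d' (T : measurableType d)
    (T' : measurableType d') (R : realType) (P : probability T R)
    (I : choiceType) (X : I -> {RV P >-> T'}) : Prop :=
  forall (J : {fset I}) (A : I -> set T'), (forall i, measurable (A i)) ->
    P (\bigcap_(i in [set` J]) (X i @^-1` A i)) =
    \prod_(i <- J) P (X i @^-1` A i).

(* [mu] is the law of [X 0 + ... + X (W - 1)], with [W] Poisson([lambda]) and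
   the [X i] of law [Q].  The family [oapp X W], indexed by [option nat],
   consists of [W] (at [None]) and of the [X i] (at [Some i]); its mutual
   independence says that the [X i] are independent of each other and that the
   sequence [X] is independent of [W]. *)
Definition compound_poisson (R : realType) (lambda : R)
    (Q mu : probability nat R) : Prop :=
  exists (d : measure_display) (T : measurableType d) (P : probability T R)
      (W : {RV P >-> nat}) (X : nat -> {RV P >-> nat}),
    [/\ forall k : nat, distribution P W [set k] = (poisson_pmf lambda k)%:E,
        forall (i : nat) (A : set nat), distribution P (X i) A = Q A,
        mutually_independent (oapp X W)
      & forall A : set nat,
          mu A = P ((fun w => (\sum_(i < W w) X i w)%N) @^-1` A)].

(* Meant for [g] nonnegative; [0 log 0 = 0] holds in both terms, since
   [ln 0 = 0] and [0 * -oo = 0]. *)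
Definition entropy d (T : measurableType d) (R : realType)
    (mu : probability T R) (g : T -> R) : \bar R :=
  \int[mu]_x (g x * ln (g x))%:E
  - (\int[mu]_x (g x)%:E) * lne (\int[mu]_x (g x)%:E).

Definition fdiff (R : realType) (j : nat) (f : nat -> R) (k : nat) : R :=
  (f (k + j)%N - f k)%R.

(* Main.v *)
(* Let [T h x = E h(x + X)] with [X] of law [Q], and let [P = (1 - p) I + p T]
   be one step of a lazy walk, with [p = lambda / (n + lambda)].  By Poisson's
   limit theorem, [P^n h 0] tends to [E_mu h] for bounded [h], so it suffices to
   bound the entropy of the binomial sum, and then to let [n] grow.  Write
   [B(u, v) = u log (u / v) - u + v].  As the entropy of [g] is the minimum over
   [c] of the mean of [B(g, c)], the choice [c = g x] bounds the entropy of one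
   step from [x] by [p G_g x], where [G_g x = E B(g(x + X), g x)].  The chain
   rule for the entropy and the joint convexity of [B], which gives
   [G_(P g) <= P G_g], sum these bounds up to
   [n * (p / (1 - p)) * P^n G_g = lambda * P^n G_g].  Finally, for [g = e^f],
   [B(g(k + j), g k) = e^(f k) (r e^r - e^r + 1)] with [r = D^j f k], and
   replacing [r] by [|r|] increases the right-hand side. *)
Require Import Defs.
From HB Require Import structures.
From mathcomp Require Import all_boot all_order all_algebra finmap.
From mathcomp Require Import all_classical all_reals all_analysis.
From mathcomp Require Import measurable_realfun.
From mathcomp Require Import ring lra.
Import Order.TTheory GRing.Theory Num.Theory.
Import numFieldNormedType.Exports.
Set Implicit Arguments.
Unset Strict Implicit.
Local Open Scope classical_set_scope.
Local Open Scope ring_scope.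

(** * The Bregman divergence of x log x *)

Section xlnx.
Context {R : realType}.
Implicit Types a b r t : R.

Definition xlnx a : R := a * ln a.

(** [xlnx a] minus the tangent of [xlnx] at [b], evaluated at [a]. *)
Definition breg a b : R := a * ln a - a * ln b - a + b.

(** [ln (1 + u) <= u] at [u = b / a - 1], times [a]. *)
Lemma xlnx_diff_le {a b} : 0 < a -> 0 < b -> a * ln b - a * ln a <= b - a.
Proof.
move=> a0 b0; have h : ln (b / a) = ln b - ln a by rewrite ln_div.
have : ln (1 + (b / a - 1)) <= b / a - 1.
  by apply: le_ln1Dx; rewrite ltrBrDl subrr divr_gt0.
rewrite (_ : 1 + _ = b / a); last by ring.
rewrite h => /(ler_wpM2l (ltW a0)).
rewrite mulrBr => /le_trans -> //.
by rewrite mulrBr mulr1 mulrCA mulfV ?gt_eqF// mulr1.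
Qed.

Lemma breg_ge0 {a b} : 0 < a -> 0 < b -> 0 <= breg a b.
Proof. by move=> a0 b0; have := xlnx_diff_le a0 b0; rewrite /breg; lra. Qed.

(* Support hyperplane of the homogeneous convex function [breg] along the ray
   [a = b * r]. *)
Lemma breg_ge {a b r} : 0 < a -> 0 < b -> 0 < r ->
  a * ln r + b * (1 - r) <= breg a b.
Proof.
move=> a0 b0 r0; have br0 : 0 < b * r by rewrite mulr_gt0.
(* The claim is [breg a (b * r) >= 0] with the logarithm expanded. *)
have := breg_ge0 a0 br0; rewrite /breg lnM//; lra.
Qed.

(** Equality in [breg_ge] at [r = a / b]: [breg] is the maximum of its linear supports. *)
Lemma breg_ratio {a b} : 0 < a -> 0 < b ->
  breg a b = a * ln (a / b) + b * (1 - a / b).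
Proof.
move=> a0 b0; rewrite /breg ln_div// mulrBr mulrBr mulr1.
by rewrite (mulrC b (a / b)) divfK ?gt_eqF//; ring.
Qed.

(** Both sides vanish at [0], and their difference [h] has derivative [u * (e^u - e^(-u))],
    nonnegative for [u >= 0]. *)
Lemma sinh_le_mul_cosh t : 0 <= t ->
  expR t - expR (- t) <= t * (expR t + expR (- t)).
Proof.
move=> t0.
pose h u : R := u * (expR u + expR (- u)) - (expR u - expR (- u)).
have dh x : is_derive x (1 : R) h (x * (expR x - expR (- x))).
  have dN : is_derive x (1 : R) (fun u => expR (- u)) (- expR (- x)).
    by rewrite -mulrN1; apply: (@is_derive1_comp R expR (-%R)).
  have := is_deriveB (is_deriveM (is_derive_id x (1 : R))
    (is_deriveD (is_derive_expR x) dN)) (is_deriveB (is_derive_expR x) dN).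
  by move=> /is_derive_eq; apply; rewrite /GRing.scale/= !fctE; ring.
have ch : continuous h.
  by move=> x; apply/differentiable_continuous/derivable1_diffP; case: (dh x).
suff : h 0 <= h t by rewrite /h oppr0 mul0r !subrr subr_ge0.
apply: (@ger0_derive1_ndecry R h 0) => //.
- move=> x; rewrite in_itv/= andbT => x0.
  rewrite derive1E; have [_ ->] := dh x.
  by rewrite mulr_ge0 ?subr_ge0 ?ler_expR ?ge0_cp ?ltW.
- exact: continuous_subspaceT.
Qed.

(** For [t < 0] this is [sinh_le_mul_cosh] at [- t], rearranged. *)
Lemma xexp_le_norm t :
  t * expR t - expR t + 1 <= `|t| * expR `|t| - expR `|t| + 1.
Proof.
have [t0|t0] := leP 0 t; first by rewrite ger0_norm.
rewrite ltr0_norm//; have := @sinh_le_mul_cosh (- t).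
rewrite opprK oppr_ge0 => /(_ (ltW t0)); lra.
Qed.

Lemma breg_expR s t :
  breg (expR s) (expR t) =
  expR t * ((s - t) * expR (s - t) - expR (s - t) + 1).
Proof.
rewrite /breg !expRK expRB.
by field; rewrite gt_eqF// expR_gt0.
Qed.
End xlnx.

(** * Means of bounded functions *)

Section bounded.
Context {R : realType}.
Implicit Types h : nat -> R.

Lemma bounded_natfunP h : bounded_fun h <-> exists M, forall x, `|h x| <= M.
Proof.
have FF : ProperFilter (globally [set: nat]).
  exact: (@globally_properfilter _ _ 0%N).
rewrite /bounded_fun ex_bound; split=> -[M hM]; exists M => x.
  exact: (hM x).
by move=> _; exact: hM.
Qed.

Lemma bounded_fun_cst (c : R) : bounded_fun (fun _ : nat => c).
Proof. by apply/bounded_natfunP; exists `|c|. Qed.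

Lemma bounded_funZ (c : R) h : bounded_fun h -> bounded_fun (fun x => c * h x).
Proof.
move=> /bounded_natfunP[M hM]; apply/bounded_natfunP; exists (`|c| * M) => x.
by rewrite normrM ler_wpM2l.
Qed.

Lemma bounded_funDf h1 h2 : bounded_fun h1 -> bounded_fun h2 ->
  bounded_fun (fun x => h1 x + h2 x).
Proof.
move=> /bounded_natfunP[M hM] /bounded_natfunP[N hN]; apply/bounded_natfunP.
by exists (M + N) => x; rewrite (le_trans (ler_normD _ _))// lerD.
Qed.

Lemma bounded_fun_itv h (a b : R) : (forall x, a <= h x <= b) -> bounded_fun h.
Proof.
move=> ab; apply/bounded_natfunP; exists (`|a| + `|b|) => x.
have /andP[ha hb] := ab x.
rewrite ler_norml; apply/andP; split.
  rewrite opprD; have := ler_norm (- a); have := normr_ge0 b.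
  by rewrite normrN; lra.
by have := ler_norm b; have := normr_ge0 a; lra.
Qed.

Lemma bounded_fun_comp (u : nat -> nat) h : bounded_fun h ->
  bounded_fun (fun x => h (u x)).
Proof.
by move=> /bounded_natfunP[M hM]; apply/bounded_natfunP; exists M => x.
Qed.
End bounded.

(** * Expectations and Tonelli's theorem on [nat] *)

Section mean.
Context {R : realType} (Q : probability nat R).
Implicit Types h : nat -> R.

Lemma bounded_integrable h : bounded_fun h ->
  Q.-integrable [set: nat] (EFin \o h).
Proof.
move=> bh; apply: measurable_bounded_integrable => //.
by rewrite (le_lt_trans (probability_le1 Q _))// ltry.
Qed.

Lemma bounded_mean_fin h : bounded_fun h ->
  (\int[Q]_x (h x)%:E)%E = (\int[Q]_x h x)%:E.
Proof.
move=> bh; rewrite /Rintegral fineK//.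
by apply: integrable_fin_num => //; exact: bounded_integrable.
Qed.

Lemma meanD h1 h2 : bounded_fun h1 -> bounded_fun h2 ->
  \int[Q]_x (h1 x + h2 x) = \int[Q]_x h1 x + \int[Q]_x h2 x.
Proof. by move=> b1 b2; rewrite RintegralD//; exact: bounded_integrable. Qed.

Lemma meanZ c h : bounded_fun h -> \int[Q]_x (c * h x) = c * \int[Q]_x h x.
Proof. by move=> b; rewrite RintegralZl//; exact: bounded_integrable. Qed.

Lemma mean_cst (c : R) : \int[Q]_(x in [set: nat]) c = c.
Proof.
by rewrite Rintegral_cst// [fine _](congr1 fine (probability_setT Q)) mulr1.
Qed.

Lemma le_mean h1 h2 : bounded_fun h1 -> bounded_fun h2 ->
  (forall x, h1 x <= h2 x) -> \int[Q]_x h1 x <= \int[Q]_x h2 x.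
Proof.
by move=> b1 b2 h12; apply: le_Rintegral => //; exact: bounded_integrable.
Qed.

Lemma mean_itv h a b : (forall x, a <= h x <= b) -> a <= \int[Q]_x h x <= b.
Proof.
move=> hab; have bh := bounded_fun_itv hab.
rewrite -[leLHS]mean_cst -[X in _ && (_ <= X)]mean_cst.
by apply/andP; split; apply: le_mean => //; try exact: bounded_fun_cst;
  move=> x; case/andP: (hab x).
Qed.

Lemma ge0_integral_series (h : nat -> \bar R) : (forall j, 0 <= h j)%E ->
  (\int[Q]_j h j = \sum_(j <oo) Q [set j] * h j)%E.
Proof.
move=> h0; have -> : [set: nat] = \bigcup_j [set j].
  by rewrite eqEsubset; split => // j _; exists j.
rewrite ge0_integral_bigcup//; first last.
  by move=> i j _ _ [x [/= -> ->]].
apply: eq_eseriesr => j _.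
rewrite (@eq_integral _ _ _ _ _ (cst (h j))) ?integral_cst 1?muleC//.
by move=> x /set_mem ->.
Qed.

(** The integral against [Q] is a series of nonnegative terms, which commutes with the other
    integral. *)
Lemma ge0_integral_swap d (T : measurableType d)
    (mu : {measure set T -> \bar R}) (F : nat -> T -> \bar R) :
    (forall j, measurable_fun setT (F j)) -> (forall j x, 0 <= F j x)%E ->
  (\int[Q]_j \int[mu]_x F j x = \int[mu]_x \int[Q]_j F j x)%E.
Proof.
move=> mF F0; rewrite ge0_integral_series//; last first.
  by move=> j; exact: integral_ge0.
transitivity (\int[mu]_x \sum_(j <oo) (Q [set j] * F j x))%E; last first.
  by apply: eq_integral => x _; rewrite ge0_integral_series.
rewrite integral_nneseries//.
- by apply: eq_eseriesr => j _; rewrite ge0_integralZl.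
- by move=> j; exact: measurable_funeM.
- by move=> j x _; rewrite mule_ge0.
Qed.

End mean.

(** The bound [K] keeps the inner means finite, so that Tonelli's identity descends to real
    integrals. *)
Lemma mean_swap {R : realType} (Q mu : probability nat R)
    (F : nat -> nat -> R) (K : R) : (forall i j, 0 <= F i j <= K) ->
  \int[Q]_j \int[mu]_i F i j = \int[mu]_i \int[Q]_j F i j.
Proof.
move=> FK; have F0 i j : 0 <= F i j by case/andP: (FK i j).
rewrite [LHS]/Rintegral [RHS]/Rintegral; congr fine.
transitivity (\int[Q]_j \int[mu]_i (F i j)%:E)%E.
  apply: eq_integral => j _; rewrite bounded_mean_fin//.
  exact: (@bounded_fun_itv _ _ 0 K).
rewrite ge0_integral_swap//; last by move=> i j; rewrite lee_fin.
apply: eq_integral => i _; rewrite bounded_mean_fin//.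
exact: (@bounded_fun_itv _ _ 0 K).
Qed.

(** * Bounds on a range away from zero *)

Section xlnx_bounds.
Context {R : realType}.
Implicit Types a b u v : R.

(** From [ln (u / v) <= ln (b / a)] and [v - u <= b]; the bound makes means of [breg] finite. *)
Lemma breg_itv a b u v : 0 < a -> a <= u <= b -> a <= v <= b ->
  0 <= breg u v <= b * (ln b - ln a) + b.
Proof.
move=> a0 /andP[au ub] /andP[av vb].
have u0 := lt_le_trans a0 au; have v0 := lt_le_trans a0 av.
have b0 := lt_le_trans u0 ub.
rewrite breg_ge0//=.
have lub : ln u <= ln b by rewrite ler_ln.
have lav : ln a <= ln v by rewrite ler_ln.
have : u * (ln u - ln v) <= u * (ln b - ln a).
  by apply: ler_wpM2l; [exact: ltW|lra].
have : u * (ln b - ln a) <= b * (ln b - ln a).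
  by rewrite ler_wpM2r// subr_ge0 ler_ln// (le_trans au).
rewrite /breg; lra.
Qed.

Lemma xlnx_ge u v : 0 < u -> 0 < v -> xlnx v + (1 + ln v) * (u - v) <= xlnx u.
Proof.
by move=> u0 v0; have := breg_ge0 u0 v0; rewrite /breg /xlnx; lra.
Qed.

Lemma bounded_fun_xlnx a b (g : nat -> R) :
  0 < a -> (forall x, a <= g x <= b) -> bounded_fun (xlnx \o g).
Proof.
move=> a0 gab.
have g0 x : 0 < g x by case/andP: (gab x) => /(lt_le_trans a0).
have b0 : 0 < b by case/andP: (gab 0%N) => _; apply: lt_le_trans.
apply/bounded_natfunP; exists (b * (`|ln a| + `|ln b|)) => x.
have /andP[ag gb] := gab x.
rewrite /xlnx /= normrM ler_pM// ?(gtr0_norm (g0 x))//.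
have lub : ln (g x) <= ln b by rewrite ler_ln ?posrE.
have lav : ln a <= ln (g x) by rewrite ler_ln ?posrE.
rewrite ler_norml; apply/andP; split.
  by have := ler_norm (- ln a); have := normr_ge0 (ln b); rewrite normrN; lra.
by have := ler_norm (ln b); have := normr_ge0 (ln a); lra.
Qed.
End xlnx_bounds.

(** * Entropy of the lazy walk *)

Section translation_mean.
Context {R : realType} (Q : probability nat R).
Implicit Types (h g : nat -> R) (p a b : R).

(** In the notation of the overview, [tmean] is [T], [breg_mean g] is [G_g] and [lazy p] is [P]. *)
Definition tmean h (x : nat) : R := \int[Q]_j h (x + j)%N.

Definition breg_mean g (x : nat) : R := \int[Q]_j breg (g (x + j)%N) (g x).

Lemma tmeanD h1 h2 : bounded_fun h1 -> bounded_fun h2 ->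
  tmean (fun y => h1 y + h2 y) = (fun x => tmean h1 x + tmean h2 x).
Proof.
by move=> b1 b2; apply/funext => x; rewrite /tmean meanD//;
  exact: bounded_fun_comp.
Qed.

Lemma tmeanZ c h : bounded_fun h ->
  tmean (fun y => c * h y) = (fun x => c * tmean h x).
Proof.
by move=> b; apply/funext => x; rewrite /tmean meanZ//; exact: bounded_fun_comp.
Qed.

Lemma le_tmean h1 h2 : bounded_fun h1 -> bounded_fun h2 ->
  (forall x, h1 x <= h2 x) -> forall x, tmean h1 x <= tmean h2 x.
Proof.
by move=> b1 b2 h12 x; apply: le_mean => //; exact: bounded_fun_comp.
Qed.

Lemma tmean_itv h a b : (forall x, a <= h x <= b) ->
  forall x, a <= tmean h x <= b.
Proof.
by move=> hab x; apply: mean_itv => j.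
Qed.

Lemma bounded_tmean h : bounded_fun h -> bounded_fun (tmean h).
Proof.
move=> /bounded_natfunP[M hM]; apply: (@bounded_fun_itv _ _ (- M) M).
by apply: tmean_itv => x; rewrite -ler_norml.
Qed.

(* One step of the walk that jumps with probability [p], by a [Q]-distributed
   amount. *)
Definition lazy p h (x : nat) : R := (1 - p) * h x + p * tmean h x.

Section lazy.
Variable p : R.
Hypotheses (p0 : 0 <= p) (p1 : p < 1).
Let q0 : 0 <= 1 - p. Proof. by rewrite subr_ge0 ltW. Qed.

Lemma bounded_lazy h : bounded_fun h -> bounded_fun (lazy p h).
Proof.
move=> bh; apply: bounded_funDf; apply: bounded_funZ => //.
exact: bounded_tmean.
Qed.

Lemma lazyD h1 h2 : bounded_fun h1 -> bounded_fun h2 ->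
  lazy p (fun y => h1 y + h2 y) = (fun x => lazy p h1 x + lazy p h2 x).
Proof.
by move=> b1 b2; apply/funext => x; rewrite /lazy tmeanD//; ring.
Qed.

Lemma lazyZ c h : bounded_fun h ->
  lazy p (fun y => c * h y) = (fun x => c * lazy p h x).
Proof. by move=> b; apply/funext => x; rewrite /lazy tmeanZ//; ring. Qed.

Lemma le_lazy h1 h2 : bounded_fun h1 -> bounded_fun h2 ->
  (forall x, h1 x <= h2 x) -> forall x, lazy p h1 x <= lazy p h2 x.
Proof.
by move=> b1 b2 h12 x; rewrite lerD// ler_wpM2l// le_tmean.
Qed.

Lemma lazy_itv h a b : (forall x, a <= h x <= b) ->
  forall x, a <= lazy p h x <= b.
Proof.
move=> hab x.
have /andP[h1 h2] := hab x; have /andP[h3 h4] := tmean_itv hab x.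
have /(ler_wpM2l q0) := h1; have /(ler_wpM2l q0) := h2.
have /(ler_wpM2l p0) := h3; have /(ler_wpM2l p0) := h4.
rewrite /lazy; lra.
Qed.

(** Translation invariance of the walk; it brings both arguments of [breg] in [breg_lazy] to the
    same point. *)
Lemma lazy_translate h j x :
  lazy p (fun y => h (y + j)%N) x = lazy p h (x + j)%N.
Proof.
rewrite /lazy /tmean; congr (_ + _ * _).
by apply: eq_Rintegral => i _; rewrite addnAC.
Qed.

Lemma bounded_iter_lazy n h : bounded_fun h -> bounded_fun (iter n (lazy p) h).
Proof. by move=> bh; elim: n => //= n; exact: bounded_lazy. Qed.

Lemma iter_lazyD n h1 h2 : bounded_fun h1 -> bounded_fun h2 ->
  iter n (lazy p) (fun y => h1 y + h2 y) =
  (fun x => iter n (lazy p) h1 x + iter n (lazy p) h2 x).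
Proof.
move=> b1 b2; elim: n => //= n ->.
by rewrite lazyD//; exact: bounded_iter_lazy.
Qed.

Lemma iter_lazyZ n c h : bounded_fun h ->
  iter n (lazy p) (fun y => c * h y) = (fun x => c * iter n (lazy p) h x).
Proof.
move=> b1; elim: n => //= n ->.
by rewrite lazyZ//; exact: bounded_iter_lazy.
Qed.

Lemma le_iter_lazy n h1 h2 : bounded_fun h1 -> bounded_fun h2 ->
  (forall x, h1 x <= h2 x) ->
  forall x, iter n (lazy p) h1 x <= iter n (lazy p) h2 x.
Proof.
move=> b1 b2 h12; elim: n => //= n IH.
by apply: le_lazy => //; exact: bounded_iter_lazy.
Qed.

Lemma iter_lazy_itv n h a b : (forall x, a <= h x <= b) ->
  forall x, a <= iter n (lazy p) h x <= b.
Proof. by move=> hab; elim: n => //= n; exact: lazy_itv. Qed.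

(** The walk preserves the degenerate range [[c, c]]. *)
Lemma iter_lazy_cst n (c : R) x : iter n (lazy p) (fun=> c) x = c.
Proof.
by apply/esym/le_anti/iter_lazy_itv => y; rewrite lexx.
Qed.

Section entropy_bound.
Context (a b : R) (a0 : 0 < a).

Lemma breg_mean_itv g : (forall x, a <= g x <= b) ->
  forall x, 0 <= breg_mean g x <= b * (ln b - ln a) + b.
Proof.
move=> gab x.
have H j := breg_itv a0 (gab (x + j)%N) (gab x).
exact: mean_itv.
Qed.

Lemma bounded_breg_mean g : (forall x, a <= g x <= b) ->
  bounded_fun (breg_mean g).
Proof. by move=> /breg_mean_itv/bounded_fun_itv. Qed.

(** For fixed [b], [breg a b] is affine in [xlnx a] and [a]. *)
Lemma breg_meanE g x : (forall x, a <= g x <= b) ->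
  breg_mean g x = tmean (xlnx \o g) x - (1 + ln (g x)) * tmean g x + g x.
Proof.
move=> gab; have bg := bounded_fun_comp (addn x) (bounded_fun_itv gab).
have bxg := bounded_fun_comp (addn x) (bounded_fun_xlnx a0 gab).
rewrite /breg_mean /tmean -mulNr -meanZ// -meanD//; last exact: bounded_funZ.
rewrite -[X in _ + X](mean_cst Q) -meanD//; last exact: bounded_fun_cst.
  by apply: eq_Rintegral => j _; rewrite /breg /xlnx /=; ring.
by apply: bounded_funDf => //; exact: bounded_funZ.
Qed.

(* The entropy of one step from [x] is at most the mean Bregman divergence to
   [g x], which vanishes on the event of no jump. *)
Lemma lazy_entropy g x : (forall x, a <= g x <= b) ->
  lazy p (xlnx \o g) x <= xlnx (lazy p g x) + p * breg_mean g x.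
Proof.
move=> gab.
have /andP[ag _] := gab x; have /andP[aPg _] := lazy_itv gab x.
(* The tangent of [xlnx] at [g x], evaluated at [lazy p g x], is the claim, since
   [lazy p g x - g x = p * (tmean g x - g x)]. *)
have := xlnx_ge (lt_le_trans a0 aPg) (lt_le_trans a0 ag).
rewrite breg_meanE//; set X := xlnx (lazy p g x).
rewrite /lazy /= [xlnx (g x)]/xlnx; lra.
Qed.

(** Jensen's inequality. With [r] the ratio of the two averages, [breg] of the averages equals their
    linear form [u * ln r + v * (1 - r)], which commutes with [lazy p] and lies pointwise below
    [breg]. *)
Lemma breg_lazy g x y : (forall x, a <= g x <= b) ->
  breg (lazy p g (x + y)%N) (lazy p g x) <=
  lazy p (fun z => breg (g (z + y)%N) (g z)) x.
Proof.
move=> gab; have Pab := lazy_itv gab.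
have gt0 z : 0 < g z by have /andP[/(lt_le_trans a0)] := gab z.
have Pgt0 z : 0 < lazy p g z by have /andP[/(lt_le_trans a0)] := Pab z.
have bg := bounded_fun_itv gab.
rewrite breg_ratio//; set r := lazy p g (x + y) / _.
have r0 : 0 < r by rewrite divr_gt0.
rewrite -lazy_translate mulrC (mulrC _ (1 - r)).
have bgy := bounded_fun_comp (addn^~ y) bg.
rewrite -(congr1 (@^~ x) (lazyZ (ln r) bgy)).
rewrite -(congr1 (@^~ x) (lazyZ (1 - r) bg)).
rewrite -(congr1 (@^~ x) (lazyD (bounded_funZ _ bgy) (bounded_funZ _ bg))).
apply: le_lazy.
- apply: bounded_funDf; apply: bounded_funZ => //.
- apply: (@bounded_fun_itv _ _ 0 (b * (ln b - ln a) + b)) => z.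
  exact: breg_itv.
- by move=> z; rewrite mulrC (mulrC (1 - r)) breg_ge.
Qed.

(** Averages [breg_lazy] over the jump [j], then exchanges this jump with the one inside [lazy]. *)
Lemma breg_mean_lazy g x : (forall x, a <= g x <= b) ->
  breg_mean (lazy p g) x <= lazy p (breg_mean g) x.
Proof.
move=> gab; have Pab := lazy_itv gab.
pose F z j := breg (g (z + j)%N) (g z).
have FK z j : 0 <= F z j <= b * (ln b - ln a) + b by exact: breg_itv.
have Fb j := lazy_itv (FK ^~ j).
apply: (@le_trans _ _ (\int[Q]_j lazy p (F^~ j) x)).
  apply: le_mean => [||j].
  - apply: (@bounded_fun_itv _ _ 0 (b * (ln b - ln a) + b)) => j.
    exact: breg_itv.
  - exact: (bounded_fun_itv (Fb^~ x)).
  - exact: breg_lazy.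
rewrite /lazy /tmean meanD; last 2 first.
- by apply: bounded_funZ; exact: (bounded_fun_itv (FK x)).
- apply: bounded_funZ.
  exact: (bounded_fun_itv (fun j => tmean_itv (FK ^~ j) x)).
rewrite (meanZ Q _ (bounded_fun_itv (FK x))).
rewrite (meanZ Q _ (bounded_fun_itv (fun j => tmean_itv (FK ^~ j) x))).
rewrite lerD2l ler_wpM2l//.
by rewrite /tmean (mean_swap Q Q (fun i j => FK (x + i)%N j)).
Qed.

(* The factor [1 / (1 - p)] pays for replacing [P^(n-1)], which the chain rule
   gives, by [P^n]: [P h >= (1 - p) h] for [h >= 0]. *)
Lemma iter_lazy_entropy n g x : (forall x, a <= g x <= b) ->
  iter n (lazy p) (xlnx \o g) x <=
  xlnx (iter n (lazy p) g x)
  + n%:R * (p / (1 - p)) * iter n (lazy p) (breg_mean g) x.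
Proof.
elim: n g x => [|n IH] g x gab; first by rewrite mul0r mul0r addr0.
(* The step nearest to [g] is peeled off, and the induction hypothesis applies to [lazy p g]. *)
have Pab := lazy_itv gab; rewrite !iterSr.
have bG := bounded_breg_mean gab; have bGP := bounded_breg_mean Pab.
set c := p / (1 - p).
have c0 : 0 <= c by rewrite divr_ge0.
have nc0 : 0 <= n%:R * c by apply: mulr_ge0.
have bX := bounded_fun_xlnx a0 Pab.
apply: (@le_trans _ _
    (iter n (lazy p) (fun y => (xlnx \o lazy p g) y + p * breg_mean g y) x)).
  apply: le_iter_lazy.
  - by apply: bounded_lazy; exact: bounded_fun_xlnx gab.
  - by apply: bounded_funDf => //; exact: bounded_funZ.
  - by move=> y; exact: lazy_entropy.
rewrite iter_lazyD//; last exact: bounded_funZ.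
rewrite (le_trans (lerD (IH _ _ Pab) (lexx _)))//.
(* Of the [n.+1] copies of [c], [n] serve the remaining steps through [breg_mean_lazy], and one pays
   for the peeled step. *)
rewrite -addrA lerD2l -natr1 mulrDl mul1r mulrDl lerD//.
  apply: ler_wpM2l => //; apply: le_iter_lazy => // [|y].
    exact: bounded_lazy.
  exact: breg_mean_lazy.
rewrite -(congr1 (@^~ x) (iter_lazyZ n c (bounded_lazy bG))).
apply: le_iter_lazy => [||y]; first exact: bounded_funZ.
  by apply: bounded_funZ; exact: bounded_lazy.
have -> : p * breg_mean g y = c * ((1 - p) * breg_mean g y).
  by rewrite mulrA divfK// subr_eq0 gt_eqF.
rewrite ler_wpM2l// lerDl mulr_ge0//.
have /andP[//] := tmean_itv (breg_mean_itv gab) y.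
Qed.
End entropy_bound.
End lazy.
End translation_mean.

(** * The Poisson limit *)

Lemma ffact_le_expn n k : (n ^_ k <= n ^ k)%N.
Proof.
elim: k n => // k IH [|n]; first by rewrite ffact0n.
rewrite ffactSS expnS leq_mul2l /=.
by rewrite (leq_trans (IH n))//; case: (k) => // j; rewrite leq_exp2r.
Qed.

(* With [p = lambda / (n + lambda)], so that [n * p = lambda * (1 - p)], the
   binomial weights are [(n ^_ k / n ^ k) * (lambda ^ k / k!) * (1 - p) ^ n]. *)
Lemma binomial_le_poisson (R : realType) (lambda p : R) n k :
  0 < lambda -> (0 < n)%N -> (k <= n)%N -> p = lambda / (n%:R + lambda) ->
  'C(n, k)%:R * p ^+ k * (1 - p) ^+ (n - k) <=
  expR (lambda * p) * poisson_pmf lambda k.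
Proof.
move=> l0 n0 kn pE.
have nR0 : 0 < n%:R :> R by rewrite ltr0n.
have D0 : 0 < n%:R + lambda by rewrite addr_gt0.
have q0 : 1 - p = n%:R / (n%:R + lambda).
  by rewrite pE; field; rewrite gt_eqF.
have qgt0 : 0 < 1 - p by rewrite q0 divr_gt0.
have pq : p = lambda / n%:R * (1 - p).
  by rewrite q0 pE; field; rewrite !gt_eqF.
rewrite {1}pq exprMn -mulrA -mulrA -exprD subnKC// /poisson_pmf l0.
have np : n%:R * p = lambda * (1 - p) by rewrite {1}pq; field; rewrite gt_eqF.
(* The [n]-th power of [1 - p <= e^(-p)], where [- n p = lambda * p - lambda]. *)
have : (1 - p) ^+ n <= expR (lambda * p) * expR (- lambda).
  rewrite -expRD (_ : lambda * p + _ = n%:R * (- p)); last first.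
    by rewrite mulrN np; ring.
  rewrite expRM_natl; apply: lerXn2r; rewrite ?nnegrE ?expR_ge0 ?expR_ge1Dx//.
  exact: ltW.
move=> /(ler_wpM2l _) H.
have fk : 'C(n, k)%:R * n%:R ^- k <= (k`!%:R^-1 : R).
  rewrite ler_pdivrMr ?exprn_gt0// mulrC ler_pdivlMr ?ltr0n ?fact_gt0//.
  by rewrite -natrM bin_ffact -natrX ler_nat ffact_le_expn.
have := ler_wpM2r (exprn_ge0 k (ltW l0)) fk.
rewrite -[leRHS]mulrC => fk'.
rewrite [leRHS]mulrCA; apply: le_trans (H _ _).
  rewrite exprMn exprVn mulrA (mulrC (_ ^+ k)) mulrA.
  by apply: ler_wpM2r => //; rewrite exprn_ge0// ltW.
by rewrite mulr_ge0 ?exprn_ge0 ?invr_ge0 ?ltW.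
Qed.

(** * Binomial expansion of the iterated walk *)

Section binomial.
Context {R : realType} (Q : probability nat R) (p : R).
Hypotheses (p0 : 0 <= p) (p1 : p < 1).
Implicit Types h : nat -> R.

Lemma bounded_iter_tmean n h : bounded_fun h ->
  bounded_fun (iter n (tmean Q) h).
Proof. by move=> bh; elim: n => //= n; exact: bounded_tmean. Qed.

Lemma iter_tmean_lazy n h x : bounded_fun h ->
  iter n (tmean Q) (lazy Q p h) x =
  (1 - p) * iter n (tmean Q) h x + p * iter n.+1 (tmean Q) h x.
Proof.
move=> bh; elim: n x => //= n IH x.
have -> : iter n (tmean Q) (lazy Q p h) = fun y =>
   (1 - p) * iter n (tmean Q) h y + p * iter n.+1 (tmean Q) h y.
  by apply/funext.
have b1 := bounded_iter_tmean n bh; have b2 := bounded_iter_tmean n.+1 bh.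
by rewrite tmeanD ?tmeanZ//; exact: bounded_funZ.
Qed.

(** The binomial theorem for [(1 - p) I + p T], by Pascal's rule. *)
Lemma iter_lazyE n h x : bounded_fun h ->
  iter n (lazy Q p) h x = \sum_(i < n.+1)
    'C(n, i)%:R * p ^+ i * (1 - p) ^+ (n - i) * iter i (tmean Q) h x.
Proof.
elim: n h => [|n IH] h bh.
  by rewrite big_ord_recl big_ord0 /= bin0; ring.
rewrite iterSr IH; last exact: bounded_lazy.
set t := fun i => iter i (tmean Q) h x.
pose b i := 'C(n, i)%:R * p ^+ i * (1 - p) ^+ (n.+1 - i) * t i.
transitivity (\sum_(i < n.+1) b i + \sum_(i < n.+1)
    'C(n, i)%:R * p ^+ i.+1 * (1 - p) ^+ (n - i) * t i.+1).
  rewrite -big_split; apply: eq_bigr => i _ /=.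
  rewrite iter_tmean_lazy// /b subSn; last by rewrite -ltnS.
  rewrite !exprS -/(t i) -/(t i.+1); ring.
(* The term [b n.+1] may be added, as ['C(n, n.+1) = 0]; the two sums then align. *)
have -> : \sum_(i < n.+1) b i = b 0%N + \sum_(i < n.+1) b i.+1.
  rewrite -(big_ord_recl n.+1 (fun i => b i)) [RHS]big_ord_recr /=.
  by rewrite /b bin_small// !mul0r addr0.
rewrite [RHS]big_ord_recl -addrA /= /b !bin0; congr (_ + _).
rewrite -big_split; apply: eq_bigr => i _ /=.
rewrite /bump /= add1n binS natrD subSS add0n /t /=; ring.
Qed.
End binomial.

(** * The compound Poisson mean as a Poisson mixture *)

Section compound_poisson.
Local Open Scope ereal_scope.
Context {R : realType} (Q : probability nat R).
Implicit Type h : nat -> \bar R.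

(** [tmean] in the extended reals, where nonnegative functions need no bound. *)
Definition etmean h (x : nat) : \bar R := \int[Q]_j h (x + j)%N.

Lemma etmean_ge0 h : (forall x, 0 <= h x) -> forall x, 0 <= etmean h x.
Proof. by move=> h0 x; apply: integral_ge0. Qed.

Lemma iter_etmean_ge0 k h : (forall x, 0 <= h x) ->
  forall x, 0 <= iter k etmean h x.
Proof. by move=> h0; elim: k => //= k; exact: etmean_ge0. Qed.

Lemma iter_etmeanE k (h : nat -> R) : bounded_fun h ->
  iter k etmean (EFin \o h) = EFin \o iter k (tmean Q) h.
Proof.
move=> bh; have bk i := bounded_iter_tmean Q i bh.
elim: k => //= k ->; apply/funext => x.
by rewrite /etmean /= bounded_mean_fin//; exact: bounded_fun_comp.
Qed.

Context d (T : measurableType d) (P : probability T R)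
  (W : {RV P >-> nat}) (X : nat -> {RV P >-> nat}).
Hypothesis XQ : forall (i : nat) (A : set nat), distribution P (X i) A = Q A.
Hypothesis indep : mutually_independent (oapp X W).

Lemma measurable_partial_sum k :
  measurable_fun setT (fun w => (\sum_(i < k) X i w)%N).
Proof.
elim: k => [|k IH].
  by under eq_fun do rewrite big_ord0; exact: measurable_cst.
under eq_fun do rewrite big_ord_recr /=.
exact: measurable_fun_addn.
Qed.

(** The events to which independence applies; [None] stands for [W] and [Some i] for [X i]. *)
Definition event (J : {fset option nat}) (A : option nat -> set nat) : set T :=
  \bigcap_(i in [set` J]) (oapp X W i @^-1` A i).

Lemma measurable_event J A : measurable (event J A).
Proof.
apply: fin_bigcap_measurable => // i _.
by rewrite -[X in measurable X]setTI; exact: measurable_funP.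
Qed.

(** On an event not involving [X 0], ..., [X (k - 1)], their sum acts as [k] independent steps.
    General [x] and [J] serve the induction: a value [a] of [X k] is added to [x], and the condition
    [X k = a] joins the event. *)
Lemma integral_partial_sum k h x J A :
    (forall y, 0 <= h y) -> (forall i, Some i \in J -> (k <= i)%N) ->
  \int[P]_(w in event J A) h (x + \sum_(i < k) X i w)%N =
  P (event J A) * iter k etmean h x.
Proof.
move=> h0; elim: k x J A => [|k IH] x J A kJ.
  under eq_integral do rewrite big_ord0 addn0.
  have := integral_cst P (measurable_event J A) (h x).
  by rewrite /cst muleC.
pose B a := fun i => if i == Some k then [set a] else A i.
have kNJ : Some k \notin J by apply/negP => /kJ; rewrite ltnn.
have XB a w : event (Some k |` J)%fset (B a) w <-> X k w = a /\ event J A w.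
  split=> [H|[Xa H] i /=].
    split.
      by have := H (Some k); rewrite /B/= eqxx; apply; rewrite fset1U1.
    move=> i iJ; have := H i; rewrite /B.
    case: eqP iJ kNJ => [->/= -> //|_ iJ _]; apply.
    by rewrite /= fset1Ur.
  rewrite /B in_fset1U; case: eqP => [->//|_ /= iJ]; exact: H.
have -> : event J A = \bigcup_a event (Some k |` J)%fset (B a).
  rewrite eqEsubset; split=> [w JAw|w [a _ /XB[]//]].
  by exists (X k w) => //; exact/XB.
have mB a := measurable_event (Some k |` J)%fset (B a).
rewrite ge0_integral_bigcup//; last 2 first.
- apply: measurable_funTS; apply: measurableT_comp => //.
  apply: measurable_fun_addn => //; exact: measurable_partial_sum.
- by move=> a b _ _ [w [/XB[<- _] /XB[<- _]]].
(* The slicing also rewrote the event on the right, where it is undone. *)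
rewrite -[X in _ = P X * _](_ : event J A = _); last first.
  rewrite eqEsubset; split=> [w JAw|w [a _ /XB[]//]].
  by exists (X k w) => //; exact/XB.
rewrite iterS /etmean ge0_integral_series; last first.
  by move=> j; exact: iter_etmean_ge0.
have PE : P (event J A) = (fine (P (event J A)))%:E.
  by rewrite fineK// fin_num_measure//; exact: measurable_event.
rewrite PE -nneseriesZl; last by move=> a _; rewrite mule_ge0// iter_etmean_ge0.
rewrite -PE; apply: eq_eseriesr => a _.
transitivity (\int[P]_(w in event (Some k |` J)%fset (B a))
    h (x + a + \sum_(i < k) X i w)%N).
  apply: eq_integral => w /set_mem/XB[Xa _].
  by rewrite big_ord_recr /= Xa addnAC addnA.
rewrite IH; last first.
  by move=> i; rewrite in_fset1U => /predU1P[[->//]|/kJ/ltnW].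
rewrite muleA (muleC (P (event J A))); congr (_ * _).
(* Independence splits off the factor [Q [set a]] of the condition on [X k]. *)
rewrite /event indep// indep// big_fsetU1//= {1}/B eqxx.
congr (_ * _); first exact: XQ.
rewrite big_seq [RHS]big_seq; apply: eq_bigr => i iJ.
by rewrite /B; case: eqP iJ kNJ => // -> ->.
Qed.
End compound_poisson.

(** Slices along [W = k]: there the random sum has exactly [k] summands, integrated out by
    [integral_partial_sum]. *)
Lemma compound_poisson_integral (R : realType) (lambda : R)
    (Q mu : probability nat R) (h : nat -> \bar R) :
  compound_poisson lambda Q mu -> (forall y, 0 <= h y)%E ->
  (\int[mu]_y h y =
   \sum_(k <oo) ((poisson_pmf lambda k)%:E * iter k (etmean Q) h 0%N))%E.
Proof.
move=> [d [T [P [W [X [WP XQ indep muE]]]]]] h0.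
pose S k w := (\sum_(i < k) X i w)%N; pose Z w := S (W w) w.
pose EW k := event W X [fset None]%fset (fun=> [set k]).
have EWE k w : EW k w <-> W w = k.
  split=> [H|wk i]; first by apply: (H None); rewrite /= in_fset1.
  by rewrite /= in_fset1 => /eqP ->.
have bigEW : [set: T] = \bigcup_k EW k.
  by rewrite eqEsubset; split=> // w _; exists (W w) => //; exact/EWE.
have mEW k : measurable (EW k) by exact: measurable_event.
have mS k : measurable_fun setT (S k) by exact: measurable_partial_sum.
have mZ : measurable_fun setT Z.
  rewrite bigEW; apply/measurable_fun_bigcup => // k.
  apply: (eq_measurable_fun (S k)); last exact: measurable_funTS.
  by move=> w /set_mem/EWE <-.
have bigZ : [set: T] = \bigcup_y Z @^-1` [set y].
  by rewrite eqEsubset; split=> // w _; exists (Z w).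
have mZy y : measurable (Z @^-1` [set y]).
  by rewrite -[X in measurable X]setTI; exact: mZ.
have mhZ : measurable_fun setT (h \o Z) by apply: measurableT_comp.
(* Transfer from [mu], the law of [Z], to [P] by summing over the values of [Z]. *)
transitivity (\int[P]_w (h \o Z) w)%E.
  rewrite ge0_integral_series// bigZ ge0_integral_bigcup//; last 3 first.
  - exact: measurable_funTS.
  - by move=> w _; exact: h0.
  - by move=> a b _ _ [w [/= <- <-]].
  apply: eq_eseriesr => y _; rewrite muE muleC -integral_cst//.
  by apply: eq_integral => w /set_mem /= <-.
rewrite bigEW ge0_integral_bigcup//; last 3 first.
- exact: measurable_funTS.
- by move=> w _; exact: h0.
- by move=> a b _ _ [w [/EWE <- /EWE <-]].
apply: eq_eseriesr => k _.
transitivity (\int[P]_(w in EW k) h (0 + \sum_(i < k) X i w)%N)%E.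
  by apply: eq_integral => w /set_mem/EWE <-.
rewrite (integral_partial_sum XQ indep)//; last by move=> i; rewrite in_fset1.
rewrite -WP; congr (P _ * _)%E.
by rewrite eqEsubset; split=> w /EWE.
Qed.

(** * Passage to the limit *)

Section poisson_limit.
Context {R : realType} (lambda : R) (Q mu : probability nat R).
Hypotheses (lambda_gt0 : 0 < lambda) (mu_CP : compound_poisson lambda Q mu).
Implicit Types h : nat -> R.

(** Jump probability for [n.+1] steps, chosen so that [p_lambda] holds exactly for every [n]. *)
Let p n : R := lambda / (n.+1%:R + lambda).

Let den_gt0 n : 0 < n.+1%:R + lambda. Proof. by rewrite addr_gt0// ltr0n. Qed.

Let p_ge0 n : 0 <= p n. Proof. by apply: divr_ge0; apply: ltW. Qed.

Let p_lt1 n : p n < 1.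
Proof. by rewrite ltr_pdivrMr// mul1r ltrDr. Qed.

Let p_lambda n : n.+1%:R * (p n / (1 - p n)) = lambda.
Proof.
rewrite /p; move: (den_gt0 n) (ltr0Sn R n); move: (n.+1%:R) => N D0 N0.
have -> : 1 - lambda / (N + lambda) = N / (N + lambda).
  by field; rewrite gt_eqF.
by field; rewrite !gt_eqF.
Qed.

(** Compares binomial and Poisson weights term by term; the rest of the Poisson series is
    nonnegative. *)
Lemma lazy_le_compound_poisson h n : bounded_fun h -> (forall x, 0 <= h x) ->
  iter n.+1 (lazy Q (p n)) h 0%N <= expR (lambda * p n) * \int[mu]_x h x.
Proof.
move=> bh h0; rewrite iter_lazyE//.
have T0 i : 0 <= iter i (tmean Q) h 0%N.
  rewrite -lee_fin -[X in (_ <= X)%E]/((EFin \o iter i (tmean Q) h) 0%N).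
  by rewrite -iter_etmeanE//; apply: iter_etmean_ge0 => x; rewrite lee_fin.
have H : \sum_(i < n.+2) poisson_pmf lambda i * iter i (tmean Q) h 0%N <=
    \int[mu]_x h x.
  rewrite -lee_fin -bounded_mean_fin//.
  rewrite (compound_poisson_integral (h := EFin \o h) mu_CP)//.
  rewrite [leLHS](_ : _ =
      (\sum_(0 <= i < n.+2)
        (poisson_pmf lambda i)%:E * iter i (etmean Q) (EFin \o h) 0%N)%E);
    last first.
    by rewrite big_mkord -sumEFin; apply: eq_bigr => i _; rewrite iter_etmeanE.
  apply: nneseries_lim_ge => i _ _.
  by rewrite iter_etmeanE// lee_fin mulr_ge0// poisson_pmf_ge0.
apply: le_trans (ler_wpM2l (expR_ge0 _) H).
rewrite mulr_sumr; apply: ler_sum => i _; rewrite mulrA ler_wpM2r//.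
by apply: binomial_le_poisson => //; rewrite -ltnS.
Qed.

Let cvg_p : p n @[n --> \oo] --> (0 : R).
Proof.
apply: (@squeeze_cvgr _ _ _ _ (cst 0) (fun n => lambda * harmonic n)).
- near=> n; rewrite p_ge0 /=; apply: ler_wpM2l; first exact: ltW.
  by rewrite /harmonic /= lef_pV2 ?posrE ?ltr0n// lerDl ltW.
- exact: cvg_cst.
- by rewrite -[X in _ --> X](mulr0 lambda); apply: cvgMr; exact: cvg_harmonic.
Unshelve. all: by end_near. Qed.

(** The one-sided comparison suffices: applied to [K + h] and [K - h], both nonnegative, it bounds
    the iterates from above and below, and [r n] tends to [1]. *)
Lemma cvg_lazy h : bounded_fun h ->
  iter n.+1 (lazy Q (p n)) h 0%N @[n --> \oo] --> \int[mu]_x h x.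
Proof.
move=> /[dup] bh /bounded_natfunP[K hK].
pose r n := expR (lambda * p n); set M := \int[mu]_x h x.
have cr : r n @[n --> \oo] --> (1 : R).
  have cl : lambda * p n @[n --> \oo] --> (0 : R).
    by rewrite -[X in _ --> X](mulr0 lambda); exact: cvgMr.
  rewrite -(@expR0 R).
  exact: (cvg_comp (fun n => lambda * p n) (@expR R) cl (@continuous_expR R 0)).
have bK := @bounded_fun_cst R K.
have bN := bounded_funZ (-1) bh.
apply: (@squeeze_cvgr _ _ _ _ (fun n => K - r n * (K - M))
   (fun n => r n * (K + M) - K)).
- near=> n; apply/andP; split.
  + have := @lazy_le_compound_poisson (fun x => K + -1 * h x) n.
    rewrite iter_lazyD// iter_lazyZ// meanD// meanZ// mean_cst.
    rewrite (iter_lazy_cst Q (p_ge0 n) (p_lt1 n)) => /(_ (bounded_funDf bK bN)).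
    rewrite -/M -/(r n) => H; have : forall x, 0 <= K + -1 * h x.
      by move=> x; have := ler_norm (h x); have := hK x; lra.
    move=> /H; lra.
  + have := @lazy_le_compound_poisson (fun x => K + h x) n.
    rewrite iter_lazyD// meanD// mean_cst.
    rewrite (iter_lazy_cst Q (p_ge0 n) (p_lt1 n)) => /(_ (bounded_funDf bK bh)).
    rewrite -/M -/(r n) => H; have : forall x, 0 <= K + h x.
      by move=> x; have := hK x; rewrite ler_norml => /andP[]; lra.
    move=> /H; lra.
- rewrite [X in _ --> X](_ : M = K - 1 * (K - M)); last by ring.
  by apply: cvgB; [exact: cvg_cst|apply: cvgMl].
- rewrite [X in _ --> X](_ : M = 1 * (K + M) - K); last by ring.
  by apply: cvgB; [apply: cvgMl|exact: cvg_cst].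
Unshelve. all: by end_near. Qed.

(** Limit of [iter_lazy_entropy] at [x = 0]; [ln] is continuous at the positive mean of [g]. *)
Lemma mean_entropy_le (a b : R) g : 0 < a -> (forall x, a <= g x <= b) ->
  \int[mu]_x xlnx (g x) <=
  xlnx (\int[mu]_x g x) + lambda * \int[mu]_x breg_mean Q g x.
Proof.
move=> a0 gab; have bg := bounded_fun_itv gab.
have bG := bounded_breg_mean Q a0 gab.
have M0 : 0 < \int[mu]_x g x.
  by have /andP[/(lt_le_trans a0)] := mean_itv mu gab.
apply: (ler_cvg_to (cvg_lazy (bounded_fun_xlnx a0 gab))
  (g := fun n => xlnx (iter n.+1 (lazy Q (p n)) g 0%N) +
    lambda * iter n.+1 (lazy Q (p n)) (breg_mean Q g) 0%N)).
  apply: cvgD; last by apply: cvgMr; exact: cvg_lazy.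
  apply: cvgM; first exact: cvg_lazy.
  by apply: continuous_cvg; [exact: continuous_ln|exact: cvg_lazy].
near=> n; rewrite -[X in X * _](p_lambda n).
exact: (iter_lazy_entropy Q _ _ a0).
Unshelve. all: by end_near. Qed.
End poisson_limit.

(** * From the divergence bound to the theorem *)

Local Open Scope ereal_scope.

(** Tonelli gives a series over the jump [j], whose terms are compared by [breg_expR] and
    [xexp_le_norm]. *)
Lemma mean_breg_mean_le (R : realType) (Q mu : probability nat R)
    (f : nat -> R) (a b : R) :
  Q [set 0%N] = 0 -> (0 < a)%R -> (forall x, a <= expR (f x) <= b)%R ->
  (\int[mu]_x breg_mean Q (expR \o f) x)%:E <=
  \sum_(1 <= j <oo) (Q [set j] *
    'E_mu[(fun k => expR (f k) *
             (`|fdiff j f k| * expR `|fdiff j f k| - expR `|fdiff j f k| + 1))%R]).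
Proof.
move=> Q0 a0 fab.
have gab x : (a <= (expR \o f) x <= b)%R by exact: fab.
pose F j k := breg (expR (f (k + j)%N)) (expR (f k)).
have FK j k : (0 <= F j k <= b * (ln b - ln a) + b)%R.
  exact: (breg_itv a0 (gab (k + j)%N) (gab k)).
have F0 j k : (0 <= F j k)%R by case/andP: (FK j k).
have -> : (\int[mu]_x breg_mean Q (expR \o f) x)%:E =
    \int[Q]_j \int[mu]_k (F j k)%:E.
  rewrite ge0_integral_swap//.
  rewrite -bounded_mean_fin; last exact: (bounded_breg_mean Q a0 gab).
  apply: eq_integral => k _; rewrite bounded_mean_fin//.
  exact: (bounded_fun_itv (FK ^~ k)).
rewrite ge0_integral_series; last first.
  by move=> j; apply: integral_ge0 => k _; rewrite lee_fin.
(* The term [j = 0] is split off; its weight vanishes by [Q0]. *)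
rewrite nneseries_recl//; last first.
  move=> j _; rewrite mule_ge0//.
  by apply: integral_ge0 => k _; rewrite lee_fin.
rewrite Q0 mul0e add0e; apply: lee_nneseries => j.
  by move=> _; rewrite mule_ge0//; apply: integral_ge0 => k _; rewrite lee_fin.
move=> _; rewrite lee_wpmul2l// unlock; apply: ge0_le_integral => //.
- by move=> k _; rewrite lee_fin.
- move=> k _; rewrite lee_fin /F breg_expR.
  by rewrite ler_wpM2l ?expR_ge0// xexp_le_norm.
Qed.

Unset Implicit Arguments.
Set Strict Implicit.

Theorem theorem1 (R : realType) (lambda : R) (Q mu : probability nat R)
    (lambda_gt0 : (0 < lambda)%R) (Q0 : Q [set 0%N] = 0)
    (mu_CP : compound_poisson lambda Q mu)
    (f : nat -> R) (f_bounded : bounded_fun f) :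
  entropy mu (fun k => expR (f k)) <=
  lambda%:E * \sum_(1 <= j <oo) (Q [set j] *
    'E_mu[(fun k => expR (f k) *
             (`|fdiff j f k| * expR `|fdiff j f k| - expR `|fdiff j f k| + 1))%R]).
Proof.
have /bounded_natfunP[M fM] := f_bounded.
have fab x : (expR (- M) <= (expR \o f) x <= expR M)%R.
  by rewrite /= !ler_expR -ler_norml.
have a0 := expR_gt0 (- M).
apply: le_trans (lee_wpmul2l _ (mean_breg_mean_le mu Q0 a0 fab)); last first.
  by rewrite lee_fin ltW.
(* Positivity of the mean turns [lne] into the real [ln]. *)
have M0 : (0 < \int[mu]_x (expR \o f) x)%R.
  by have /andP[/(lt_le_trans a0)] := mean_itv mu fab.
have := mean_entropy_le lambda_gt0 mu_CP a0 fab.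
rewrite /entropy (bounded_mean_fin mu (bounded_fun_itv fab)) lne_EFin//.
rewrite (bounded_mean_fin mu (bounded_fun_xlnx a0 fab)).
rewrite -EFinM -EFinN -EFinD -EFinM lee_fin /xlnx /=; lra.
Qed.
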